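(* Let $\ell\geq 2$ and $m\geq 1$ be integers. For $k\ge 0$ let $$\zeta_k^m=\sum_{i=1}^{\ell}\Bigl(\sum_{j=1}^\ell \Sigma_{x_i}^{x_j}\,t^k\,g(t)^{\underline{m}}\,\Delta t\Bigr)\partial_i ,\qquad g(t)=(t-x_1)(t-x_2)\cdots(t-x_\ell),$$ where $\Sigma_a^b\,\cdot\,\Delta t$ denotes definite summation, $g(t)^{\underline m}$ is the falling power, and let $\widetilde{\zeta}_k^m$ be the homogenization of $\zeta_k^m$ with respect to the additional variable $z$. Let $\theta_0=\partial_1+\cdots+\partial_\ell$ and $\theta_E=z\partial_z+x_1\partial_1+\cdots+x_\ell\partial_\ell$. Then the $\ell+1$ vector fields $$\widetilde{\zeta}_0^m,\ \widetilde{\zeta}_1^m,\ \dots,\ \widetilde{\zeta}_{\ell-2}^m,\ \theta_0,\ \theta_E$$ form a basis, as a module over $\mathbb{C}[x_1,\dots,x_\ell,z]$, of the module $D(c\mathrm{Cat}_\ell(m))$ of logarithmic derivations of the cone $c\mathrm{Cat}_\ell(m)$ over the $m$-Catalan arrangement of type $A_{\ell-1}$.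
   Context: Logarithmic derivations: let $R=\mathbb{C}[x_1,\dots,x_\ell,z]$, and let $\mathrm{Der}_R=\bigoplus_{i=1}^{\ell}R\,\partial_i\oplus R\,\partial_z$ be the module of $\mathbb{C}$-linear derivations of $R$, with $\partial_i=\partial/\partial x_i$, $\partial_z=\partial/\partial z$. For a central hyperplane arrangement $\mathcal{A}$ in $\mathbb{C}^{\ell+1}$ (coordinates $x_1,\dots,x_\ell,z$), with a linear form $\alpha_H$ such that $H=\ker\alpha_H$ chosen for each $H\in\mathcal{A}$, put $D(\mathcal{A})=\{\delta\in\mathrm{Der}_R \mid \delta\alpha_H\in(\alpha_H)\text{ for all }H\in\mathcal{A}\}$, an $R$-module. The arrangement $c\mathrm{Cat}_\ell(m)$ is the central arrangement in $\mathbb{C}^{\ell+1}$ consisting of the hyperplane $z=0$ and the hyperplanes $x_i-x_j-kz=0$ for $1\le i<j\le\ell$ and integers $-m\le k\le m$. Definite summation: for a polynomial $f(t)$ in $t$ (here with coefficients in $\mathbb{C}[x_1,\dots,x_\ell]$), let $F(t)$ be a polynomial in $t$ (with coefficients in the same ring) with $F(t+1)-F(t)=f(t)$; such $F$ exists and is unique up to adding a constant (an element of the coefficient ring). Define $\Sigma_a^b f(t)\,\Delta t=F(b)-F(a)$. In particular $\Sigma_{x_i}^{x_j}f(t)\Delta t=F(x_j)-F(x_i)\in\mathbb{C}[x_1,\dots,x_\ell]$. Falling power: for an integer $n>0$, $f(t)^{\underline{n}}=f(t)f(t-1)\cdots f(t-n+1)$. Homogenization: for a polynomial vector field $\delta=\sum_{i=1}^\ell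 f_i(x_1,\dots,x_\ell)\partial_i$ (with $f_i$ not necessarily homogeneous), put $d=\max\{\deg f_1,\dots,\deg f_\ell\}$ and $\widetilde{\delta}=\sum_{i=1}^\ell z^d f_i\bigl(\tfrac{x_1}{z},\dots,\tfrac{x_\ell}{z}\bigr)\partial_i$. *)

(* Defs.v *)
From HB Require Import structures.
From mathcomp Require Import all_boot all_order all_algebra.
From mathcomp Require Import classical_sets reals.
From mathcomp Require Import complex mpoly.
From mathcomp Require Import ring.

Set Implicit Arguments.
Unset Strict Implicit.
Unset Printing Implicit Defensive.

Import Order.TTheory GRing.Theory Num.Theory.
Local Open Scope ring_scope.

Section DefiniteSummation.
Variables (K : numFieldType) (l : nat).
Local Notation A := {mpoly K[l]}.

Definition shiftp (c : A) (f : {poly A}) : {poly A} := f \Po ('X + c%:P).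

Lemma shiftp_antidiff (f : {poly A}) :
  exists F : {poly A}, shiftp 1 F - F == f.
Proof.
have sumP (I : Type) (r : seq I) (P : pred I) (G : I -> {poly A}) :
    (forall i, exists F, shiftp 1 F - F == G i) ->
    exists F, shiftp 1 F - F == \sum_(i <- r | P i) G i.
  move=> h; elim/big_ind: _ => [|x y [F /eqP <-] [F' /eqP <-]|i _]; last exact: h.
    by exists 0; rewrite /shiftp comp_poly0 subrr.
  by exists (F + F'); rewrite /shiftp comp_polyD opprD addrACA.
have scaleP (c : A) g : (exists F, shiftp 1 F - F == g) ->
    exists F, shiftp 1 F - F == c *: g.
  move=> [F /eqP <-]; exists (c *: F).
  by rewrite /shiftp comp_polyZ scalerBr.
have powP n : exists F, shiftp 1 F - F == 'X^n.
  elim/ltn_ind: n => n IHn.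
  have [|G /eqP hG] := sumP _ (index_enum 'I_n) xpredT
      (fun i : 'I_n => 'C(n.+1, i)%:R *: 'X^i).
    by move=> i; apply/scaleP/IHn.
  exists ((n.+1%:R^-1)%:MP *: ('X^(n.+1) - G)); apply/eqP.
  rewrite /shiftp comp_polyZ -scalerBr comp_polyB comp_Xn_poly.
  have -> : G \Po ('X + 1%:P) = G + \sum_(i < n) 'C(n.+1, i)%:R *: 'X^i.
    by rewrite -hG [RHS]addrC subrK.
  rewrite polyC1 [_ + 1]addrC exprDn big_ord_recr big_ord_recr /= !subnn subSnn.
  under eq_bigr do rewrite expr1n mul1r -scaler_nat.
  set s := \sum_(i < n) _.
  rewrite !expr1n !mul1r binn binSn mulr1n -scaler_nat.
  have -> : s + n.+1%:R *: 'X^n + 'X^(n.+1) - (G + s) - ('X^(n.+1) - G)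
    = n.+1%:R *: 'X^n :> {poly A}
    by move: (_ *: 'X^n) 'X^(n.+1) => a b; ring.
  rewrite scalerA -mpolyC_nat -mpolyCM mulVf ?scale1r //.
  by rewrite pnatr_eq0.
rewrite -[f]coefK poly_def; apply: sumP => i; exact/scaleP/powP.
Qed.

(* An arbitrary F with F(t+1) - F(t) = f(t); see defsumE for independence of
   the choice. *)
Definition antidiff (f : {poly A}) : {poly A} := xchoose (shiftp_antidiff f).

Definition defsum (f : {poly A}) (a b : A) : A :=
  (antidiff f).[b] - (antidiff f).[a].

Lemma antidiffK f : shiftp 1 (antidiff f) - antidiff f = f.
Proof. exact/eqP/(xchooseP (shiftp_antidiff f)). Qed.

Lemma defsumE (f F : {poly A}) (a b : A) :
  shiftp 1 F - F = f -> defsum f a b = F.[b] - F.[a].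
Proof.
move=> hF; rewrite /defsum; set H := antidiff f.
pose D := H - F - (H - F).[0]%:P.
have DS x : (H - F).[x + 1] = (H - F).[x].
  have : shiftp 1 (H - F) - (H - F) = 0.
    have hH : shiftp 1 H - H = f by exact: antidiffK.
    have -> : shiftp 1 (H - F) = shiftp 1 H - shiftp 1 F.
      by rewrite /shiftp comp_polyB.
    by rewrite opprD addrACA hH -opprD hF subrr.
  move/(congr1 (fun p => p.[x])); rewrite /shiftp hornerD hornerN horner0.
  by rewrite horner_comp !hornerE => /eqP; rewrite subr_eq0 => /eqP.
have Dn (n : nat) : root D n%:R.
  apply/rootP; rewrite /D hornerD hornerN hornerC.
  elim: n => [|n IHn]; first by rewrite subrr.
  by rewrite -natr1 DS.
have D0 : D = 0.
  apply/eqP/(contraT _) => Dnz.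
  have := @max_poly_roots _ D [seq i%:R | i <- iota 0 (size D)] Dnz.
  rewrite size_map size_iota ltnn; apply.
    by apply/allP => _ /mapP[i _ ->].
  rewrite map_inj_uniq ?iota_uniq // => i j /eqP.
  by rewrite -!mpolyC_nat mpolyC_eq eqr_nat => /eqP.
have HE x : H.[x] = F.[x] + (H - F).[0].
  have /eqP : D.[x] = 0 by rewrite D0 horner0.
  rewrite /D hornerD hornerN hornerC subr_eq0 => /eqP <-.
  by rewrite hornerD hornerN addrC subrK.
by rewrite !HE opprD addrACA subrr addr0.
Qed.

Definition fallpow (f : {poly A}) (n : nat) : {poly A} :=
  \prod_(r < n) shiftp (- r%:R) f.

End DefiniteSummation.

Section VectorFields.
Variables (K : numFieldType).

(* The row vector d stands for the derivation \sum_i (d 0 i) * \partial_i. *)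
Definition deriv_app n (d : 'rV[{mpoly K[n]}]_n) (p : {mpoly K[n]}) :
    {mpoly K[n]} :=
  \sum_(i < n) d 0 i * p^`M(i).

(* In K[x_1, .., x_l, z] the index of x_i is lift ord_max i, and that of z is
   ord_max. *)
Definition xidx l (i : 'I_l) : 'I_l.+1 := lift ord_max i.
Definition zidx l : 'I_l.+1 := ord_max.

(* z^d * f(x_1/z, .., x_l/z), for d at least the degree of f
   (see meval_homogenize) *)
Definition homogenize l (d : nat) (f : {mpoly K[l]}) : {mpoly K[l.+1]} :=
  \sum_(u <- msupp f)
    f@_u *: ('X_(zidx l) ^+ (d - mdeg u) * \prod_(i < l) 'X_(xidx i) ^+ u i).

Lemma meval_homogenize l d (f : {mpoly K[l]}) (v : 'I_l.+1 -> K) :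
  (msize f <= d.+1)%N -> v (zidx l) != 0 ->
  (homogenize d f).@[v] =
    v (zidx l) ^+ d * f.@[fun i => v (xidx i) / v (zidx l)].
Proof.
move=> hd vz; rewrite /homogenize raddf_sum /= [in RHS]mevalE mulr_sumr.
apply: eq_big_seq => u /msize_mdeg_lt hu.
have {}hu : (mdeg u <= d)%N by rewrite -ltnS (leq_trans hu).
rewrite mevalZ mevalM [RHS]mulrCA; congr (_ * _).
rewrite (rmorphXn (meval v)) (rmorph_prod (meval v)) /= mevalXU.
have -> : \prod_(i < l) ('X_(xidx i) ^+ u i).@[v] = \prod_(i < l) v (xidx i) ^+ u i.
  by apply: eq_bigr => i _; rewrite rmorphXn /= mevalXU.
under [in RHS]eq_bigr do rewrite expr_div_n.
rewrite prodf_div prodrXr -mdegE -[in RHS](subnK hu) exprD -!mulrA.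
by congr (_ * _); rewrite mulrC divfK // expf_neq0.
Qed.

Definition vfdeg l (d : 'rV[{mpoly K[l]}]_l) : nat :=
  \max_(i < l) (msize (d 0%R i)).-1.

Definition vfhomogenize l (d : 'rV[{mpoly K[l]}]_l) : 'rV[{mpoly K[l.+1]}]_l.+1 :=
  \row_(j < l.+1)
    if unlift (zidx l) j is Some i then homogenize (vfdeg d) (d 0 i) else 0.

Definition gpoly l : {poly {mpoly K[l]}} := \prod_(i < l) ('X - ('X_i)%:P).

Definition zeta l (m k : nat) : 'rV[{mpoly K[l]}]_l :=
  \row_(i < l) \sum_(j < l) defsum ('X^k * fallpow (gpoly l) m) 'X_i 'X_j.

Definition theta0 l : 'rV[{mpoly K[l.+1]}]_l.+1 :=
  \row_(j < l.+1) (j != zidx l)%:R.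

Definition thetaE l : 'rV[{mpoly K[l.+1]}]_l.+1 := \row_(j < l.+1) 'X_j.

End VectorFields.

Section Arrangements.
Local Open Scope classical_set_scope.
Variables (K : numFieldType).

Definition zeros n (p : {mpoly K[n]}) : set 'rV[K]_n :=
  [set v | p.@[fun i => v 0 i] = 0].

(* alpha chooses, for each H in the arrangement, a linear form with kernel H *)
Definition defining_forms n (Arr : set (set 'rV[K]_n))
    (alpha : set 'rV[K]_n -> {mpoly K[n]}) : Prop :=
  forall H, Arr H -> alpha H \is 1.-homog /\ zeros (alpha H) = H.

Definition logder n (Arr : set (set 'rV[K]_n))
    (alpha : set 'rV[K]_n -> {mpoly K[n]}) : set 'rV[{mpoly K[n]}]_n :=
  [set d | forall H, Arr H ->
     exists q : {mpoly K[n]}, deriv_app d (alpha H) = q * alpha H].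

Definition cCat l (m : nat) : set (set 'rV[K]_l.+1) :=
  [set H | H = [set v : 'rV[K]_l.+1 | v 0 (zidx l) = 0] \/
     exists (i j : 'I_l) (k : int),
       [/\ (i < j)%N, - m%:Z <= k <= m%:Z &
           H = [set v : 'rV[K]_l.+1 |
                v 0 (xidx i) - v 0 (xidx j) - k%:~R * v 0 (zidx l) = 0]]].

End Arrangements.

Definition module_basis (A : comNzRingType) (V : lmodType A) (M : set V)
    (s : seq V) : Prop :=
  (forall d : V,
     M d <-> exists c : 'I_(size s) -> A, d = \sum_(i < size s) c i *: s`_i) /\
  (forall c : 'I_(size s) -> A,
     \sum_(i < size s) c i *: s`_i = 0 -> forall i, c i = 0).

(* Main.v *)
Require Import Defs.
From HB Require Import structures.
From mathcomp Require Import all_boot all_order all_algebra.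
From mathcomp Require Import boolp classical_sets reals.
From mathcomp Require Import complex mpoly.
From mathcomp Require Import ring zify.

Import Order.TTheory GRing.Theory Num.Theory.
Local Open Scope ring_scope.
Local Open Scope complex_scope.

(** Saito's criterion: if the rows of a square matrix M are logarithmic, the sum
of their degrees is at most the number of hyperplanes, and det M is nonzero,
then det M is a nonzero scalar multiple of the product Q of the defining forms,
and Cramer's rule expresses every logarithmic derivation in the rows of M.
Restriction to the hyperplane X_a = b is the substitution X_a := b, a morphism
into an integral domain killing exactly the multiples of X_a - b.

The difference of the i-th and j-th components of zeta_k is l (F(x_j) - F(x_i)),
where F is the antidifference of f(t) = t^k g(t)^(falling m).  On
x_i = x_j + c with 0 <= c <= m it is a sum of the values of f at
x_j, .., x_j + c - 1, which all vanish; hence zeta_k is logarithmic.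

For det M <> 0, evaluate at z = 1 and x_i = (m + 1) i.  Between x_i and x_(i+1)
the only summation point with f(t) <> 0 is t_i = x_i + m, so a linear dependence
between the rows gives a polynomial of degree < l - 1 vanishing at
t_0, .., t_(l-2). *)

Set Implicit Arguments.
Unset Strict Implicit.
Unset Printing Implicit Defensive.

(** * Saito's criterion *)

(** Induction dividing out one [beta i] at a time: for [j != i], [phi j] does not kill [beta i], so
    in a domain it kills the quotient. *)
Lemma dvd_prod_of_morphisms (A : idomainType) (I : eqType) (s : seq I)
    (beta : I -> A) (phi : I -> {rmorphism A -> A}) (p : A) :
  uniq s ->
  (forall i q, i \in s -> phi i q = 0 -> exists r, q = r * beta i) ->
  (forall i j, i \in s -> j \in s -> i != j -> phi i (beta j) != 0) ->
  (forall i, i \in s -> phi i p = 0) ->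
  exists q, p = q * \prod_(i <- s) beta i.
Proof.
elim: s p => [|i s IHs] p /=; first by move=> *; exists p; rewrite big_nil mulr1.
case/andP=> nis us hdvd hne hp.
have [q pE] := hdvd i p (mem_head _ _) (hp i (mem_head _ _)).
have [||j js|r qE] := IHs q us.
- by move=> j r js; apply: hdvd; rewrite in_cons js orbT.
- by move=> j k js ks; apply: hne; rewrite in_cons ?js ?ks orbT.
- have js' : j \in i :: s by rewrite in_cons js orbT.
  have ji : j != i by apply: contraNneq nis => <-.
  move: (hp j js'); rewrite pE rmorphM => /eqP; rewrite mulf_eq0.
  by rewrite (negPf (hne j i js' (mem_head _ _) ji)) orbF => /eqP.
by exists r; rewrite pE qE big_cons mulrAC mulrA.
Qed.

(** Multiplying by the adjugate gives [\det N *: w = 0], and a nonzero entry of [w] cancels in the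
    domain. *)
Lemma det_eq0_mulcol (A : idomainType) n (N : 'M[A]_n) (w : 'cV[A]_n) :
  w != 0 -> N *m w = 0 -> \det N = 0.
Proof.
move=> w0 Nw; have : \det N *: w = 0.
  by rewrite -mul_scalar_mx -mul_adj_mx -mulmxA Nw mulmx0.
move/eqP; apply: contraTeq => d0; apply: contra w0 => /eqP dw.
apply/eqP/matrixP => i j; move/matrixP: dw => /(_ i j) /eqP.
by rewrite !mxE mulf_eq0 (negPf d0) => /eqP.
Qed.

Section Degree.
Variables (K : fieldType) (n : nat).
Local Notation A := {mpoly K[n]}.
Implicit Types p q : A.

(** As [msize] is the degree plus one, and zero at [0], bounds of the shape [msize p <= d.+1] also
    cover zero factors. *)
Lemma msizeM_leq p q d e :
  (msize p <= d.+1 -> msize q <= e.+1 -> msize (p * q) <= (d + e).+1)%N.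
Proof.
move=> hp hq; have [->|p0] := eqVneq p 0; first by rewrite mul0r mmeasure0.
have [->|q0] := eqVneq q 0; first by rewrite mulr0 mmeasure0.
by rewrite msizeM //; move: (msize p) (msize q) hp hq => a b; lia.
Qed.

Lemma msize_sum_leq (I : Type) (r : seq I) (P : pred I) (F : I -> A) d :
  (forall i, P i -> msize (F i) <= d)%N ->
  (msize (\sum_(i <- r | P i) F i) <= d)%N.
Proof.
move=> h; elim/big_ind: _ => [|x y hx hy|//]; first by rewrite mmeasure0.
by apply: leq_trans (msizeD_le _ _) _; rewrite geq_max hx.
Qed.

Lemma msize_prod_leq (I : Type) (r : seq I) (F : I -> A) (d : I -> nat) :
  (forall i, msize (F i) <= (d i).+1)%N ->
  (msize (\prod_(i <- r) F i) <= (\sum_(i <- r) d i).+1)%N.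
Proof.
move=> h; elim: r => [|i r IH]; first by rewrite !big_nil msize1.
by rewrite !big_cons; apply: msizeM_leq.
Qed.

(** Each Leibniz term takes one entry from every row, so the row bounds add up. *)
Lemma msize_det_leq k (M : 'M[A]_k) (d : 'I_k -> nat) :
  (forall i j, msize (M i j) <= (d i).+1)%N ->
  (msize (\det M) <= (\sum_i d i).+1)%N.
Proof.
move=> h; apply: msize_sum_leq => s _.
case: (perm.odd_perm s); rewrite ?expr1 ?expr0 ?mulN1r ?msizeN ?mul1r;
by apply: msize_prod_leq => i.
Qed.

Lemma msize_prod_linear (I : eqType) (r : seq I) (F : I -> A) :
  (forall i, i \in r -> msize (F i) = 2)%N ->
  msize (\prod_(i <- r) F i) = (size r).+1.
Proof.
elim: r => [|i r IH] h; first by rewrite big_nil msize1.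
have hi : msize (F i) = 2 by apply: h; rewrite mem_head.
have {}IH : msize (\prod_(i <- r) F i) = (size r).+1.
  by apply: IH => j jr; apply: h; rewrite in_cons jr orbT.
by rewrite big_cons msizeM -?msize_poly_eq0 ?IH ?hi.
Qed.

End Degree.

Section Saito.
Variables (K : numFieldType) (n : nat).
Local Notation A := {mpoly K[n]}.
Variables (I : eqType) (s : seq I) (beta : I -> A).
Variable phi : I -> {rmorphism A -> A}.
Hypothesis us : uniq s.
Hypothesis phi_dvd : forall i p, phi i p = 0 -> exists q, p = q * beta i.
Hypothesis phi_beta : forall i, i \in s -> phi i (beta i) = 0.
Hypothesis phi_neq : forall i j,
  i \in s -> j \in s -> i != j -> phi i (beta j) != 0.
Hypothesis phi_grad : forall i, i \in s -> exists a, phi i (beta i)^`M(a) != 0.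
Hypothesis size_beta : forall i, i \in s -> msize (beta i) = 2.

Definition logarithmic (d : 'rV[A]_n) :=
  forall i, i \in s -> exists q, deriv_app d (beta i) = q * beta i.

(** On the hyperplane of [beta i] every row annihilates the gradient of [beta i], which is nonzero
    there; so the restricted determinant vanishes. *)
Lemma det_logarithmic_dvd (N : 'M[A]_n) :
  (forall r, logarithmic (row r N)) ->
  exists q, \det N = q * \prod_(i <- s) beta i.
Proof.
move=> hN; apply: dvd_prod_of_morphisms => // [i q _|i j|i si];
  [exact: phi_dvd|exact: phi_neq|].
rewrite -det_map_mx.
apply: (@det_eq0_mulcol _ _ _ (\col_a phi i (beta i)^`M(a))).
  have [a ha] := phi_grad si; apply: contraNneq ha => /matrixP/(_ a 0).
  by rewrite !mxE => ->.
apply/matrixP => r j; rewrite !mxE.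
have [q] := hN r i si; move/(congr1 (phi i)).
rewrite rmorphM (phi_beta si) mulr0 rmorph_sum /=.
by move=> hq; apply: etrans hq; apply: eq_bigr => a _; rewrite !mxE rmorphM.
Qed.

Lemma saito_criterion (M : 'M[A]_n) (deg : 'I_n -> nat) :
  (forall r, logarithmic (row r M)) ->
  (forall r c, msize (M r c) <= (deg r).+1)%N ->
  (\sum_r deg r <= size s)%N ->
  \det M != 0 ->
  forall d, logarithmic d -> exists c : 'rV[A]_n, d = c *m M.
Proof.
move=> hM hdeg hsum det0 d hd; set Q := \prod_(i <- s) beta i.
have [q qE] := det_logarithmic_dvd hM; rewrite -/Q in qE.
have /andP[q0 Q0] : (q != 0) && (Q != 0) by rewrite -negb_or -mulf_eq0 -qE.
have sQ : msize Q = (size s).+1 by exact: msize_prod_linear.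
(* [Q] has degree [size s], which also bounds the degree of [\det M]; hence [q] is constant. *)
have : (msize q <= 1)%N.
  have := msize_det_leq hdeg; rewrite qE msizeM // sQ; move: (msize q) => a; lia.
move/msize1_polyC => qC; set c := q@_0 in qC.
have c0 : c != 0 by apply: contra q0 => /eqP c0; rewrite qC c0 mpolyC0.
(* Cramer's rule: this entry is the determinant of [M] with row [i] replaced by [d], and all rows of
   that matrix are logarithmic. *)
have hrow i : exists e, (d *m \adj M) 0 i = e * Q.
  pose N := \matrix_(r, j) if r == i then d 0 j else M r j.
  have [|e eE] := @det_logarithmic_dvd N.
    move=> r; have [->|ri] := eqVneq r i.
      by rewrite (_ : row i N = d) //; apply/rowP => j; rewrite !mxE eqxx.
    rewrite (_ : row r N = row r M) //; apply/rowP => j.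
    by rewrite !mxE (negPf ri).
  exists e; rewrite -eE (expand_det_row _ i) mxE; apply: eq_bigr => j _.
  rewrite !mxE eqxx; congr (_ * (_ * \det _)).
  by apply/matrixP => x y; rewrite !mxE eq_sym (negPf (neq_lift _ _)).
have [e eE] : exists e : 'rV[A]_n, d *m \adj M = Q *: e.
  have [e he] := @fin_all_exists _ _ _ hrow.
  by exists (\row_i e i); apply/rowP => i; rewrite !mxE mulrC -he !mxE.
(* From [d *m \adj M *m M = \det M *: d] and [\det M = c Q] one gets [Q c d = Q e M]; cancel [Q],
   then divide by [c]. *)
exists (c^-1%:MP *: e).
have : Q *: (c%:MP *: d) = Q *: (e *m M).
  rewrite scalerA mulrC -qC -qE -mul_mx_scalar -mul_adj_mx mulmxA eE.
  by rewrite scalemxAl.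
move/(congr1 (fun u : 'rV_n => fun j => u 0 j)) => h.
apply/rowP => j; have /= := congr1 (fun f => f j) h.
rewrite !mxE => /(mulfI Q0) h'; rewrite -[LHS]mul1r.
have -> : 1 = c^-1%:MP * c%:MP :> A by rewrite -mpolyCM mulVf.
rewrite -mulrA h' mulr_sumr; apply: eq_bigr => a _.
by rewrite !mxE mulrA.
Qed.

Lemma logarithmicZ a d : logarithmic d -> logarithmic (a *: d).
Proof.
move=> h i si; have [q hq] := h i si; exists (a * q).
rewrite -mulrA -hq /deriv_app mulr_sumr.
by apply: eq_bigr => j _; rewrite mxE mulrA.
Qed.

Lemma logarithmic_sum (J : Type) (r : seq J) (d : J -> 'rV[A]_n) :
  (forall j, logarithmic (d j)) -> logarithmic (\sum_(j <- r) d j).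
Proof.
move=> h; elim/big_ind: _ => [|x y hx hy|//] i si.
  exists 0; rewrite mul0r /deriv_app big1 // => j _.
  by rewrite mxE mul0r.
have [q hq] := hx i si; have [q' hq'] := hy i si; exists (q + q').
rewrite mulrDl -hq -hq' /deriv_app -big_split.
by apply: eq_bigr => j _; rewrite mxE mulrDl.
Qed.

Lemma saito_module_basis (b : seq 'rV[A]_n) (deg : 'I_n -> nat) :
  size b = n ->
  (forall r : 'I_n, logarithmic b`_r) ->
  (forall (r : 'I_n) c, msize (b`_r 0%R c) <= (deg r).+1)%N ->
  (\sum_r deg r <= size s)%N ->
  \det (\matrix_(r < n, c < n) b`_r 0 c) != 0 ->
  module_basis logarithmic b.
Proof.
move=> sb hb hdeg hsum; set M := \matrix_(_, _) _ => detM.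
have rowM r : row r M = b`_r by apply/rowP => c; rewrite !mxE.
have lin (c : 'I_n -> A) : \sum_(i < n) c i *: b`_i = (\row_i c i) *m M.
  rewrite mulmx_sum_row; apply: eq_bigr => i _.
  by rewrite rowM mxE.
(* [size b] occurs in the index types, so it is generalized before being replaced by [n]. *)
rewrite /module_basis; move: (size b) sb => k ->; split=> [d|c].
  split=> [hd|[c ->]]; last by apply: logarithmic_sum => i; apply: logarithmicZ.
  have [||c ->] := @saito_criterion M deg _ _ hsum detM d hd.
  - by move=> r; rewrite rowM.
  - by move=> r c; rewrite mxE.
  exists (c 0); rewrite lin; congr (_ *m _).
  by apply/rowP => i; rewrite mxE.
rewrite lin => cM0 i.
have : \det M *: \row_i c i = 0.
  by rewrite -mul_mx_scalar -mul_mx_adj mulmxA cM0 mul0mx.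
move/rowP/(_ i)/eqP; rewrite !mxE mulf_eq0 (negPf detM).
by move/eqP.
Qed.

End Saito.

(** * Substitution of a variable *)

Section Substitution.
Variables (K : numFieldType) (n : nat).
Local Notation A := {mpoly K[n]}.
Implicit Types (p b : A) (a : 'I_n).

Definition subst_var a b : A -> A :=
  comp_mpoly [tuple if i == a then b else 'X_i | i < n].

HB.instance Definition _ a b := GRing.RMorphism.copy (subst_var a b)
  (comp_mpoly [tuple if i == a then b else 'X_i | i < n]).

Lemma subst_varC a b c : subst_var a b c%:MP = c%:MP.
Proof. exact: comp_mpolyC. Qed.

Lemma subst_varX a b i : subst_var a b 'X_i = if i == a then b else 'X_i.
Proof. by rewrite /subst_var comp_mpolyXU -tnth_nth tnth_mktuple. Qed.

Lemma meval_subst_var a b p v :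
  (subst_var a b p).@[v] = p.@[fun i => if i == a then b.@[v] else v i].
Proof.
rewrite /subst_var comp_mpoly_meval; apply: meval_eq => i.
by rewrite tnth_mktuple; case: eqP => //; rewrite mevalXU.
Qed.

Lemma mpoly_closed_ind (P : A -> Prop) :
  (forall c, P c%:MP) -> (forall i, P 'X_i) ->
  (forall p q, P p -> P q -> P (p + q)) ->
  (forall p q, P p -> P q -> P (p * q)) -> forall p, P p.
Proof.
move=> hC hX hD hM; elim/mpolyind => [|c m p _ _ hp].
  by rewrite -mpolyC0; apply: (hC).
apply: hD => //; rewrite -mul_mpolyC; apply: (hM); first exact: hC.
rewrite mpolyXE_id; elim/big_rec: _ => [|i q _ hq].
  by rewrite -mpolyC1; apply: (hC).
apply: (hM) => //; elim: (m i) => [|k IH]; first by rewrite expr0 -mpolyC1.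
by rewrite exprS; apply: (hM).
Qed.

(** ['X_a] and [b] are congruent modulo ['X_a - b], and congruence respects sums and products. *)
Lemma sub_subst_var_dvd a b p : exists q, p - subst_var a b p = q * ('X_a - b).
Proof.
elim/mpoly_closed_ind: p => [c|i|p q [p' hp] [q' hq]|p q [p' hp] [q' hq]].
- by exists 0; rewrite subst_varC subrr mul0r.
- rewrite subst_varX; case: eqP => [->|_]; first by exists 1; rewrite mul1r.
  by exists 0; rewrite subrr mul0r.
- by exists (p' + q'); rewrite rmorphD opprD addrACA hp hq mulrDl.
- exists (p' * q + subst_var a b p * q'); rewrite rmorphM mulrDl -mulrA.
  by rewrite [q * _]mulrC mulrA -hp -mulrA -hq; ring.
Qed.

Lemma subst_var_eq0_dvd a b p :
  subst_var a b p = 0 -> exists q, p = q * ('X_a - b).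
Proof. by move=> h; have [q] := sub_subst_var_dvd a b p; rewrite h subr0; exists q. Qed.

Lemma mpoly_rmorphism_ext (B : pzRingType) (f g : {rmorphism A -> B}) :
  (forall c, f c%:MP = g c%:MP) -> (forall i, f 'X_i = g 'X_i) -> f =1 g.
Proof.
move=> hC hX; elim/mpoly_closed_ind => // p q hp hq.
  by rewrite !rmorphD hp hq.
by rewrite !rmorphM hp hq.
Qed.

Lemma msize_linear p a : (msize p <= 2)%N -> p@_U_(a) != 0 -> msize p = 2.
Proof.
move=> hp; rewrite -mcoeff_msupp => /msize_mdeg_lt; rewrite mdeg1 => h.
by apply/eqP; rewrite eqn_leq hp.
Qed.

Lemma msize_subX_const a (c : K) : msize ('X_a - c%:MP : A) = 2.
Proof.
apply: (@msize_linear _ a); last first.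
  by rewrite mcoeffB mcoeffX mcoeffC eqxx mnm1_eq0 mulr0 subr0 oner_eq0.
apply: leq_trans (msizeD_le _ _) _; rewrite msizeN msizeX msizeC mdeg1 geq_max.
by case: (c != 0).
Qed.

(** A nonzero [p] would be divisible by the product of the ['X_a - i] for [i < msize p], whose
    degree exceeds that of [p] by one. *)
Lemma subst_const_eq0 a p :
  (forall c : K, subst_var a c%:MP p = 0) -> p = 0.
Proof.
move=> hp; have [//|p0] := eqVneq p 0.
have := @dvd_prod_of_morphisms A nat (iota 0 (msize p))
  (fun i => 'X_a - i%:R%:MP) (fun i => subst_var a i%:R%:MP) p (iota_uniq _ _).
case=> [i q _|i j _ _ ij|i _|q qE].
- exact: subst_var_eq0_dvd.
- rewrite rmorphB /= subst_varX eqxx subst_varC -mpolyCB -mpolyC0 mpolyC_eq.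
  by rewrite subr_eq0 eqr_nat.
- exact: hp.
have : (msize (\prod_(i <- iota 0 (msize p)) ('X_a - i%:R%:MP) : A)
        = (msize p).+1)%N.
  by rewrite msize_prod_linear ?size_iota // => i _; apply: msize_subX_const.
set Q := \prod_(i <- _) _ in qE * => sQ.
have /andP[q0 Q0] : (q != 0) && (Q != 0) by rewrite -negb_or -mulf_eq0 -qE.
have sq : (0 < msize q)%N by rewrite lt0n msize_poly_eq0.
have := congr1 (fun u => msize u) qE; rewrite /= msizeM // sQ.
by move: (msize p) (msize q) sq => x y; lia.
Qed.

Lemma meval_eq0 p : (forall v, p.@[v] = 0) -> p = 0.
Proof.
move=> hp.
(* In [part v (n - k)] the last [k] variables are free. For [k = 0] this is evaluation; one more
   free variable is handled by specializing it to every constant. *)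
pose part (v : 'I_n -> K) k : n.-tuple A :=
  [tuple if (i < k)%N then (v i)%:MP else 'X_i | i < n].
suff h k v : (k <= n)%N -> p \mPo part v (n - k)%N = 0.
  have := h n (fun=> 0) (leqnn _); rewrite subnn.
  by rewrite (_ : part _ _ = [tuple 'X_i | i < n]) ?comp_mpoly_id.
elim: k v => [|k IH] v kn.
  have -> : p \mPo part v (n - 0)%N = (p.@[v])%:MP.
    apply: (@mpoly_rmorphism_ext _ (comp_mpoly (part v (n - 0)%N))
              (@mpolyC n K \o meval v)) => [c|i] /=.
      by rewrite comp_mpolyC mevalC.
    by rewrite comp_mpolyXU -tnth_nth tnth_mktuple subn0 ltn_ord mevalXU.
  by rewrite hp mpolyC0.
have hk : (n - k.+1 < n)%N by lia.
pose a := Ordinal hk; apply: (@subst_const_eq0 a) => c.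
pose w i := if i == a then c else v i.
rewrite -[RHS](IH w (ltnW kn)).
apply: (@mpoly_rmorphism_ext _ (subst_var a c%:MP \o comp_mpoly (part v _))
         (comp_mpoly (part w _))) => [d|i] /=.
  by rewrite !comp_mpolyC subst_varC.
rewrite !comp_mpolyXU -!tnth_nth !tnth_mktuple /w.
have [->|ia] := eqVneq i a.
  by rewrite /= ltnn subst_varX eqxx (_ : (_ < _)%N); last by lia.
have -> : (i < n - k)%N = (i < n - k.+1)%N.
  by move: ia; rewrite -val_eqE /=; lia.
by case: ifP => _; rewrite ?subst_varC // subst_varX (negPf ia).
Qed.

End Substitution.

(** * Degrees of the antidifferences *)

Section WeightedDegree.
Variables (K : numFieldType) (l : nat).
Local Notation B := {mpoly K[l]}.
Implicit Types (f g F : {poly B}).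

(* Total degree at most D when t has weight one; the truncated subtraction
   forces the coefficients of index greater than D to vanish. *)
Definition wdeg_le (D : nat) f := forall a, (msize f`_a <= D.+1 - a)%N.

Lemma wdeg_le0 D : wdeg_le D 0.
Proof. by move=> a; rewrite coef0 mmeasure0. Qed.

Lemma wdeg_leD D f g : wdeg_le D f -> wdeg_le D g -> wdeg_le D (f + g).
Proof.
move=> hf hg a; rewrite coefD; apply: leq_trans (msizeD_le _ _) _.
by rewrite geq_max hf hg.
Qed.

Lemma wdeg_leN D f : wdeg_le D f -> wdeg_le D (- f).
Proof. by move=> hf a; rewrite coefN msizeN. Qed.

Lemma wdeg_le_widen D E f : (D <= E)%N -> wdeg_le D f -> wdeg_le E f.
Proof. by move=> hDE hf a; apply: leq_trans (hf a) _; apply: leq_sub2r. Qed.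

Lemma wdeg_leM D E f g : wdeg_le D f -> wdeg_le E g -> wdeg_le (D + E) (f * g).
Proof.
move=> hf hg a; rewrite coefM; apply: msize_sum_leq => b _.
have [->|f0] := eqVneq f`_b 0; first by rewrite mul0r mmeasure0.
have [->|g0] := eqVneq g`_(a - b) 0; first by rewrite mulr0 mmeasure0.
rewrite msizeM //; have := hf b; have := hg (a - b)%N.
have : (0 < msize f`_b)%N by rewrite lt0n msize_poly_eq0.
have : (0 < msize g`_(a - b))%N by rewrite lt0n msize_poly_eq0.
have := ltn_ord b.
move: (msize f`_b) (msize g`_(a - b)) => x y; lia.
Qed.

Lemma wdeg_le_polyC D (c : B) : (msize c <= D.+1)%N -> wdeg_le D c%:P.
Proof. by move=> hc [|a]; rewrite coefC ?subn0 // mmeasure0. Qed.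

Lemma wdeg_le_polyXn n : wdeg_le n 'X^n.
Proof.
move=> a; rewrite coefXn; case: eqP => [->|_] /=; last by rewrite mmeasure0.
by rewrite msize1 subSnn.
Qed.

Lemma wdeg_leZ D E (c : B) f :
  (msize c <= E.+1)%N -> wdeg_le D f -> wdeg_le (E + D) (c *: f).
Proof.
by move=> hc hf; rewrite -mul_polyC; apply: wdeg_leM => //; apply: wdeg_le_polyC.
Qed.

Lemma wdeg_le_prod k (F : 'I_k -> {poly B}) d :
  (forall i, wdeg_le d (F i)) -> wdeg_le (k * d) (\prod_(i < k) F i).
Proof.
elim: k F => [|k IH] F h.
  by rewrite big_ord0 -polyC1; apply: wdeg_le_polyC; rewrite msize1.
by rewrite big_ord_recl mulSn; apply: wdeg_leM => //; apply: IH.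
Qed.

(** The coefficient of [t^a] has degree at most [D - a], and [x ^+ a] adds at most [a]. *)
Lemma msize_horner_leq D F (x : B) :
  wdeg_le D F -> (msize x <= 2)%N -> (msize F.[x] <= D.+1)%N.
Proof.
move=> hF hx; rewrite horner_coef; apply: msize_sum_leq => a _.
have [->|Fa0] := eqVneq F`_a 0; first by rewrite mul0r mmeasure0.
have hxa : (msize (x ^+ a) <= (a : nat).+1)%N.
  elim: (a : nat) => [|k IH]; first by rewrite expr0 msize1.
  by rewrite exprS; apply: (@msizeM_leq _ _ _ _ 1 k).
have := hF a; have : (0 < msize F`_a)%N by rewrite lt0n msize_poly_eq0.
move=> h1 h2; have h3 : (msize F`_a <= (D - a).+1)%N.
  by move: (msize _) h1 h2 => u; lia.
apply: leq_trans (msizeM_leq h3 hxa) _.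
by move: (msize _) h1 h2 => u; lia.
Qed.

(** The constant term of the arbitrary choice [antidiff f] may have any degree, so the bound is
    attached to some antidifference; [defsumE] transfers it to [defsum]. *)
Definition has_antidiff_wdeg D f :=
  exists2 F : {poly B}, shiftp 1 F - F = f & wdeg_le D F.

Lemma has_antidiff_wdeg_sum D (I : Type) (r : seq I) (f : I -> {poly B}) :
  (forall i, has_antidiff_wdeg D (f i)) ->
  has_antidiff_wdeg D (\sum_(i <- r) f i).
Proof.
move=> h; elim/big_ind: _ => [|x y [F <- wF] [G <- wG]|//].
  by exists 0; rewrite ?/shiftp ?comp_poly0 ?subrr //; apply: wdeg_le0.
exists (F + G); last exact: wdeg_leD.
by rewrite /shiftp comp_polyD opprD addrACA.
Qed.

Lemma has_antidiff_wdegZ D E c f : (msize c <= E.+1)%N ->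
  has_antidiff_wdeg D f -> has_antidiff_wdeg (E + D) (c *: f).
Proof.
move=> hc [F <- wF]; exists (c *: F); last exact: wdeg_leZ.
by rewrite /shiftp comp_polyZ scalerBr.
Qed.

Lemma has_antidiff_wdeg_widen D E f :
  (D <= E)%N -> has_antidiff_wdeg D f -> has_antidiff_wdeg E f.
Proof. by move=> hDE [F <- /(wdeg_le_widen hDE) wF]; exists F. Qed.

(** The difference of [t^(n+1)] is [(n+1) t^n] plus lower powers; an antidifference [G] of the
    latter is subtracted, and the result divided by [n+1]. *)
Lemma has_antidiff_wdeg_Xn n : has_antidiff_wdeg n.+1 'X^n.
Proof.
have mC (c : K) : (msize (c%:MP : B) <= 1)%N by rewrite msizeC; case: (c != 0).
elim/ltn_ind: n => n IHn.
have [|G hG wG] := @has_antidiff_wdeg_sum n.+1 _ (index_enum 'I_n)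
    (fun i : 'I_n => 'C(n.+1, i)%:R%:MP *: 'X^i).
  move=> i; apply: (@has_antidiff_wdegZ _ 0); first exact: mC.
  by apply: has_antidiff_wdeg_widen (IHn i _) => //; apply: leqW.
exists ((n.+1%:R^-1)%:MP *: ('X^(n.+1) - G)).
  rewrite /shiftp comp_polyZ -scalerBr comp_polyB comp_Xn_poly.
  have -> : G \Po ('X + 1%:P) = G + \sum_(i < n) 'C(n.+1, i)%:R%:MP *: 'X^i.
    by rewrite -hG [RHS]addrC subrK.
  rewrite polyC1 [_ + 1]addrC exprDn big_ord_recr big_ord_recr /= !subnn subSnn.
  have -> : \sum_(i < n) 1 ^+ (n.+1 - i) * 'X^i *+ 'C(n.+1, i)
            = \sum_(i < n) 'C(n.+1, i)%:R%:MP *: 'X^i :> {poly B}.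
    by apply: eq_bigr => i _; rewrite expr1n mul1r -scaler_nat mpolyC_nat.
  set s := \sum_(i < n) _.
  rewrite !expr1n !mul1r binn binSn mulr1n -scaler_nat.
  have -> : s + n.+1%:R *: 'X^n + 'X^(n.+1) - (G + s) - ('X^(n.+1) - G)
    = n.+1%:R *: 'X^n :> {poly B}
    by move: (_ *: 'X^n) 'X^(n.+1) => a b; ring.
  by rewrite scalerA -mpolyC_nat -mpolyCM mulVf ?scale1r // pnatr_eq0.
apply: (@wdeg_leZ n.+1 0); first exact: mC.
by apply: wdeg_leD; [exact: wdeg_le_polyXn|exact: wdeg_leN].
Qed.

Lemma wdeg_le_has_antidiff D f : wdeg_le D f -> has_antidiff_wdeg D.+1 f.
Proof.
move=> hf; rewrite -[f]coefK poly_def; apply: has_antidiff_wdeg_sum => i.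
have [->|fi0] := eqVneq f`_i 0.
  rewrite scale0r; exists 0; last exact: wdeg_le0.
  by rewrite /shiftp comp_poly0 subrr.
have h1 : (0 < msize f`_i)%N by rewrite lt0n msize_poly_eq0.
have h2 := hf i.
have h3 : (i <= D)%N by move: (msize _) h1 h2 => u; lia.
have -> : D.+1 = (D - i + i.+1)%N by lia.
by apply: has_antidiff_wdegZ (has_antidiff_wdeg_Xn i); rewrite -subSn.
Qed.

(** A product of [m * l] factors [t - r - x_i], each of weighted degree one. *)
Lemma wdeg_le_fallpow m : wdeg_le (m * l) (fallpow (gpoly K l) m).
Proof.
apply: wdeg_le_prod => r; rewrite /gpoly /shiftp rmorph_prod /=.
rewrite -[X in wdeg_le X](muln1 l); apply: wdeg_le_prod => i.
rewrite comp_polyB comp_polyX comp_polyC -addrA -polyCN -polyCD.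
apply: wdeg_leD; first exact: (@wdeg_le_polyXn 1).
apply: wdeg_le_polyC; apply: leq_trans (msizeD_le _ _) _.
rewrite !msizeN msizeX mdeg1 geq_max -mpolyC_nat msizeC.
by case: (_ != 0).
Qed.

Lemma has_antidiff_wdeg_zeta k m :
  has_antidiff_wdeg (k + m * l).+1 ('X^k * fallpow (gpoly K l) m).
Proof.
apply: wdeg_le_has_antidiff; apply: wdeg_leM; first exact: wdeg_le_polyXn.
exact: wdeg_le_fallpow.
Qed.

Lemma msize_zeta_leq k m (i : 'I_l) :
  (msize (zeta K l m k 0%R i) <= (k + m * l).+2)%N.
Proof.
have [F hF wF] := has_antidiff_wdeg_zeta k m.
rewrite mxE; apply: msize_sum_leq => j _; rewrite (defsumE _ _ hF).
apply: leq_trans (msizeD_le _ _) _.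
by rewrite msizeN geq_max !msize_horner_leq // msizeX mdeg1.
Qed.

Lemma vfdeg_zeta_leq k m : (vfdeg (zeta K l m k) <= (k + m * l).+1)%N.
Proof.
apply/bigmax_leqP => i _; have := msize_zeta_leq k m i.
by move: (msize _) => u; lia.
Qed.

Lemma msize_homogenize_leq d (f : B) :
  (msize f <= d.+1)%N -> (msize (homogenize d f) <= d.+1)%N.
Proof.
move=> hf; rewrite /homogenize big_seq; apply: msize_sum_leq => u /msize_mdeg_lt hu.
apply: leq_trans (msizeZ_le _ _) _.
have hd : d = (d - mdeg u + mdeg u)%N.
  by rewrite subnK // -ltnS (leq_trans hu).
rewrite [X in (_ <= X.+1)%N]hd; apply: msizeM_leq.
  by rewrite mpolyXn msizeX mdegMn mdeg1 mul1n.
rewrite [in X in (_ <= X.+1)%N]mdegE; apply: msize_prod_leq => i.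
by rewrite mpolyXn msizeX mdegMn mdeg1 mul1n.
Qed.

Lemma msize_leq_vfdeg (d : 'rV[B]_l) (i : 'I_l) :
  (msize (d 0%R i) <= (vfdeg d).+1)%N.
Proof.
have := @leq_bigmax _ (fun i => (msize (d 0 i)).-1) i; rewrite -/(vfdeg d).
by move: (msize _) => u; lia.
Qed.

Lemma msize_vfhomogenize_leq (d : 'rV[B]_l) (j : 'I_l.+1) :
  (msize (vfhomogenize d 0%R j) <= (vfdeg d).+1)%N.
Proof.
rewrite mxE; case: unliftP => [i _|_]; last by rewrite mmeasure0.
exact/msize_homogenize_leq/msize_leq_vfdeg.
Qed.

End WeightedDegree.

(** * The cone over the Catalan arrangement *)

Section Cone.
Variables (K : numFieldType) (l m : nat).
Local Notation B := {mpoly K[l]}.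
Local Notation A := {mpoly K[l.+1]}.
Local Notation hyperplane_index := (option ('I_l * 'I_l * 'I_m.*2.+1))%type.
Implicit Types (H : hyperplane_index) (p q : A).

Lemma xidx_neq_zidx (i : 'I_l) : (xidx i == zidx l) = false.
Proof. by rewrite eq_sym; apply/negbTE/neq_lift. Qed.

Lemma xidx_inj : injective (@xidx l).
Proof. exact: lift_inj. Qed.

(* [None] stands for z = 0, and [Some (i, j, k)] for x_i - x_j = (k - m) z. *)
Definition offset (k : 'I_m.*2.+1) : int := k%:Z - m%:Z.

(** Every form is a pivot variable minus [cone_value], so that restriction to its hyperplane is a
    substitution for the pivot. *)
Definition cone_pivot H : 'I_l.+1 :=
  if H is Some (i, _, _) then xidx i else zidx l.

Definition cone_value H : A :=
  if H is Some (_, j, k) then 'X_(xidx j) + (offset k)%:~R%:MP * 'X_(zidx l)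
  else 0.

Definition cone_form H : A := 'X_(cone_pivot H) - cone_value H.

Definition cone_restrict H : {rmorphism A -> A} :=
  subst_var (cone_pivot H) (cone_value H).

Definition lt_pairs : seq ('I_l * 'I_l) :=
  [seq p : 'I_l * 'I_l <- enum {: 'I_l * 'I_l} | (p.1 < p.2)%N].

Definition cone_indices : seq hyperplane_index :=
  None :: [seq Some (ij, k) | ij <- lt_pairs, k <- enum 'I_m.*2.+1].

Lemma mem_cone_indices H :
  (H \in cone_indices) = if H is Some (i, j, _) then (i < j)%N else true.
Proof.
rewrite in_cons; case: H => [[[i j] k]|] //=.
apply/allpairsP/idP => [[[p k'] [+ _ []]] /=|ij].
  by rewrite mem_filter => /andP[+ _] E _; rewrite -E.
exists (i, j, k); split=> //; last exact: mem_enum.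
by rewrite mem_filter mem_enum /= ij.
Qed.

Lemma uniq_cone_indices : uniq cone_indices.
Proof.
apply/andP; split; first by apply/allpairsP => -[ij []].
apply: allpairs_uniq; [exact: (filter_uniq _ (enum_uniq {: 'I_l * 'I_l}))
                     |exact: enum_uniq|].
by move=> [p k] [p' k'] _ _ [-> ->].
Qed.

Lemma size_cone_indices :
  size cone_indices = ((\sum_(j < l) j) * m.*2.+1).+1.
Proof.
rewrite /= size_allpairs size_enum_ord /lt_pairs size_filter -sum1_count.
rewrite big_enum_cond; congr ((_ * _).+1).
(* The pairs are counted by their larger member: [j] has [j] predecessors. *)
transitivity (\sum_(i < l) \sum_(j < l | (i < j)%N) 1)%N.
  by rewrite pair_big_dep.
rewrite (exchange_big_dep xpredT) //=; apply: eq_bigr => j _.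
by rewrite -(big_ord_widen l (fun=> 1%N)) ?sum1_card ?card_ord // ltnW.
Qed.

Lemma meval_form H (v : 'I_l.+1 -> K) : (cone_form H).@[v] =
  if H is Some (i, j, k)
  then v (xidx i) - v (xidx j) - (offset k)%:~R * v (zidx l) else v (zidx l).
Proof.
rewrite /cone_form; case: H => [[[i j] k]|] /=; last by rewrite subr0 mevalXU.
by rewrite mevalB mevalD mevalM !mevalXU mevalC opprD addrA.
Qed.

(** As [i < j], the pivot does not occur in [cone_value H], which the substitution therefore
    fixes. *)
Lemma restrict_form H : H \in cone_indices -> cone_restrict H (cone_form H) = 0.
Proof.
rewrite mem_cone_indices /cone_restrict /cone_form rmorphB /= subst_varX eqxx.
case: H => [[[i j] k]|] /= ij; last by rewrite raddf0 subrr.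
rewrite [subst_var _ _ (_ + _)]rmorphD /= [subst_var _ _ (_ * _)]rmorphM /=.
rewrite subst_varC !subst_varX (inj_eq xidx_inj).
rewrite [zidx l == _]eq_sym xidx_neq_zidx -val_eqE /= gtn_eqF //.
by rewrite subrr.
Qed.

Lemma meval_restrict H p (v : 'I_l.+1 -> K) :
  (cone_form H).@[v] = 0 -> (cone_restrict H p).@[v] = p.@[v].
Proof.
rewrite /cone_form mevalB mevalXU => /eqP; rewrite subr_eq0 => /eqP h.
by rewrite meval_subst_var; apply: meval_eq => i; case: eqP => // ->.
Qed.

(** [w] is the projection of [v] onto the hyperplane along the pivot coordinate. *)
Lemma form_meval_restrict H p (v : 'I_l.+1 -> K) : H \in cone_indices ->
  exists2 w, (cone_form H).@[w] = 0 &
    (forall i, i != cone_pivot H -> w i = v i) /\ (cone_restrict H p).@[v] = p.@[w].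
Proof.
move=> Hs.
set w := fun i => if i == cone_pivot H then (cone_value H).@[v] else v i.
exists w; last by split=> [i /negPf iH|]; [rewrite /w iH|exact: meval_subst_var].
rewrite -(meval_subst_var (cone_pivot H) (cone_value H)) -/(cone_restrict H).
by rewrite restrict_form ?meval0.
Qed.

(** It suffices to find a point on the hyperplane of [H] that is not on that of [H']. *)
Lemma restrict_form_neq0 H H' : H \in cone_indices -> H' \in cone_indices ->
  H != H' -> cone_restrict H (cone_form H') != 0.
Proof.
rewrite !mem_cone_indices => Hs Hs' HH'.
suff [v v0] : exists2 v : 'I_l.+1 -> K,
    (cone_form H).@[v] = 0 & (cone_form H').@[v] != 0.
  by apply: contraNneq => h; rewrite -(meval_restrict _ v0) h meval0.
pose vec (x : 'I_l -> K) z (c : 'I_l.+1) : K :=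
  if unlift (zidx l) c is Some i then x i else z.
have vecx x z i : vec x z (xidx i) = x i by rewrite /vec /xidx liftK.
have vecz x z : vec x z (zidx l) = z by rewrite /vec unlift_none.
case: H H' Hs Hs' HH' => [[[i j] k]|] [[[i' j'] k']|] //= ij ij' HH'; first last.
- exists (vec (fun c => (c == i')%:R) 0); rewrite !meval_form !(vecx, vecz) //.
  by rewrite eqxx -val_eqE /= gtn_eqF // mulr0 !subr0 oner_eq0.
- exists (vec (fun c => (c == i)%:R * (offset k)%:~R) 1).
    rewrite !meval_form !(vecx, vecz) eqxx -val_eqE /= gtn_eqF //.
    by rewrite mul0r subr0 mul1r mulr1 subrr.
  by rewrite meval_form vecz oner_eq0.
(* For equal pairs the offsets differ, so any point with [z = 1] on the first hyperplane misses the
   second. *)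
have [/andP[/eqP ii /eqP jj]|ne] := boolP ((i' == i) && (j' == j)).
  exists (vec (fun c => (c == i)%:R * (offset k)%:~R) 1).
    rewrite !meval_form !(vecx, vecz) eqxx -val_eqE /= gtn_eqF //.
    by rewrite mul0r subr0 mul1r mulr1 subrr.
  rewrite meval_form !(vecx, vecz) ii jj eqxx -[j == i]val_eqE /= gtn_eqF // mul0r subr0.
  rewrite mul1r mulr1 subr_eq0 eqr_int; apply: contra HH' => /eqP h.
  rewrite ii jj; apply/eqP; congr (Some (_, _, _)); apply: val_inj.
  by case: (addIr _ h).
(* At this point with [z = 0], the coordinates [i] and [j] are the only two that coincide. *)
exists (vec (fun c => (if c == i then j : nat else c)%:R) 0).
  by rewrite meval_form !(vecx, vecz) eqxx -val_eqE /= gtn_eqF // mulr0 !subrr.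
rewrite meval_form !(vecx, vecz) mulr0 subr0 subr_eq0 eqr_nat.
move: ne; rewrite -!val_eqE /=.
by case: (nat_of_ord i' =P i) => h1; case: (nat_of_ord j' =P i) => h2; lia.
Qed.

Lemma mderivXU (i j : 'I_l.+1) : 'X_i^`M(j) = (i == j)%:R :> A.
Proof.
rewrite mderivX mnm1E; case: eqP => [->|_]; last by rewrite scale0r.
by rewrite -{1}[U_(j)%MM]add0m addmK mpolyX0 scale1r.
Qed.

Lemma deriv_app_form (d : 'rV[A]_l.+1) H : deriv_app d (cone_form H) =
  if H is Some (i, j, k)
  then d 0 (xidx i) - d 0 (xidx j) - (offset k)%:~R%:MP * d 0 (zidx l)
  else d 0 (zidx l).
Proof.
have dX i : \sum_(c < l.+1) d 0 c * 'X_i^`M(c) = d 0 i.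
  rewrite (bigD1 i) //= mderivXU eqxx mulr1 big1 ?addr0 // => c ci.
  by rewrite mderivXU eq_sym (negPf ci) mulr0.
rewrite /deriv_app /cone_form /cone_value; case: H => [[[i j] k]|] /=; last first.
  by rewrite -[RHS]dX; apply: eq_bigr => c _; rewrite subr0.
rewrite -!dX mulr_sumr -!sumrB; apply: eq_bigr => c _.
by rewrite mderivB mderivD mderiv_mulC; ring.
Qed.

Lemma mderiv_form_pivot H : H \in cone_indices -> (cone_form H)^`M(cone_pivot H) = 1.
Proof.
move=> Hs; have := deriv_app_form (\row_c (c == cone_pivot H)%:R) H.
rewrite /deriv_app (bigD1 (cone_pivot H)) //= mxE eqxx mul1r big1 ?addr0; last first.
  by move=> c /negPf cH; rewrite mxE cH mul0r.
move=> ->; move: Hs; rewrite mem_cone_indices.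
case: H => [[[i j] k]|] /= ij; rewrite !mxE ?eqxx // (inj_eq xidx_inj).
rewrite [zidx l == _]eq_sym xidx_neq_zidx -val_eqE /= gtn_eqF //.
by rewrite mulr0 !subr0.
Qed.

Lemma msize_form H : H \in cone_indices -> msize (cone_form H) = 2.
Proof.
move=> Hs; apply: (@msize_linear _ _ _ (cone_pivot H)).
  have mX i : (msize ('X_i : A) <= 2)%N by rewrite msizeX mdeg1.
  apply: leq_trans (msizeD_le _ _) _; rewrite msizeN geq_max mX /=.
  case: H {Hs} => [[[i j] k]|] /=; last by rewrite mmeasure0.
  apply: leq_trans (msizeD_le _ _) _; rewrite geq_max mX /=.
  by rewrite mul_mpolyC; apply: leq_trans (msizeZ_le _ _) (mX _).
(* The constant term of the derivative is the coefficient of the pivot variable. *)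
have := congr1 (fun p => p@_0) (mderiv_form_pivot Hs).
rewrite /= mcoeff_deriv mcoeff1 eqxx mnm0E mulr1n add0m => ->.
exact: oner_neq0.
Qed.

Lemma row_vecE (v : 'I_l.+1 -> K) p :
  p.@[fun i => (\row_j v j) 0 i] = p.@[v].
Proof. by apply: meval_eq => i; rewrite mxE. Qed.

Lemma cCatP (S : set 'rV[K]_l.+1) :
  @cCat K l m S <-> exists2 H, H \in cone_indices & S = zeros (cone_form H).
Proof.
split=> [[->|[i [j [k [ij km ->]]]]]|[[[[i j] k]|] Hs ->]].
- exists None; first by rewrite mem_cone_indices.
  by apply/funext => v; rewrite /zeros /= meval_form.
- have hk : (`|(k + m%:Z)%R| < m.*2.+1)%N by move: km => /andP[]; lia.
  have ko : offset (Ordinal hk) = k by rewrite /offset /=; move: km => /andP[]; lia.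
  exists (Some (i, j, Ordinal hk)); first by rewrite mem_cone_indices.
  by apply/funext => v; rewrite /zeros /= meval_form ko.
- right; exists i, j, (offset k); split.
  + by rewrite mem_cone_indices in Hs.
  + by rewrite /offset; have := ltn_ord k; lia.
  by apply/funext => v; rewrite /zeros /= meval_form.
- by left; apply/funext => v; rewrite /zeros /= meval_form.
Qed.

(** Vanishing on the hyperplane makes [p] a multiple of [cone_form H], and the degrees force a
    constant quotient. *)
Lemma linear_form_eqZ H p : H \in cone_indices -> p \is 1.-homog ->
  zeros p = zeros (cone_form H) -> exists2 c, c != 0 & p = c *: cone_form H.
Proof.
move=> Hs ph pz.
have memz q (v : 'I_l.+1 -> K) : zeros q (\row_i v i) <-> q.@[v] = 0.
  by rewrite /zeros /= row_vecE.
have [q qE] : exists q, p = q * cone_form H.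
  apply/subst_var_eq0_dvd/meval_eq0 => v.
  have [w w0 [_ ->]] := form_meval_restrict p v Hs.
  by apply/memz; rewrite pz; apply/memz.
have f0 : cone_form H != 0 by rewrite -msize_poly_eq0 msize_form.
have p0 : p != 0.
  apply: contra f0 => /eqP p0; apply/eqP/meval_eq0 => v.
  by apply/memz; rewrite -pz; apply/memz; rewrite p0 meval0.
have q0 : q != 0 by apply: contra p0 => /eqP q0; rewrite qE q0 mul0r.
have : (msize p <= 2)%N.
  rewrite msizeE; apply/bigmax_leqP_seq => u us _.
  by rewrite (dhomog_mf ph us).
rewrite qE msizeM // msize_form // addn2 /= ltnS => /msize1_polyC qC.
exists (q@_0); last by rewrite {1}qC mul_mpolyC.
by apply: contra q0 => /eqP c0; rewrite qC c0 mpolyC0.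
Qed.

(** Each chosen form is a nonzero scalar multiple of the explicit one, which does not affect
    divisibility. *)
Lemma logder_cCatP (alpha : set 'rV[K]_l.+1 -> A) (d : 'rV[A]_l.+1) :
  defining_forms (@cCat K l m) alpha ->
  logder (@cCat K l m) alpha d <-> logarithmic cone_indices cone_form d.
Proof.
move=> halpha; have aE H : H \in cone_indices ->
    exists2 c, c != 0 & alpha (zeros (cone_form H)) = c *: cone_form H.
  move=> Hs; have [|ah az] := halpha (zeros (cone_form H)).
    by apply/cCatP; exists H.
  exact: linear_form_eqZ.
have dZ c p : deriv_app d (c *: p) = c *: deriv_app d p.
  rewrite /deriv_app scaler_sumr; apply: eq_bigr => i _.
  by rewrite mderivZ scalerAr.
split=> [h H Hs|h S /cCatP[H Hs ->]]; have [c c0 cE] := aE H Hs.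
  have [|q] := h (zeros (cone_form H)); first by apply/cCatP; exists H.
  rewrite cE dZ -scalerAr => /(congr1 (fun p => c^-1 *: p)).
  by rewrite !scalerA mulVf // !scale1r => ->; exists q.
have [q hq] := h H Hs; exists q.
by rewrite cE dZ hq scalerAr.
Qed.

End Cone.

(** * The derivations zeta and their determinant *)

Section Zeta.
Variables (K : numFieldType) (l m : nat).
Local Notation B := {mpoly K[l]}.
Local Notation A := {mpoly K[l.+1]}.
Implicit Types (y : 'I_l -> K).

Definition antidiff_at k y : {poly K} :=
  map_poly (meval y) (antidiff ('X^k * fallpow (gpoly K l) m)).

Lemma antidiff_at_shift k y t :
  (antidiff_at k y).[t + 1] - (antidiff_at k y).[t] =
  t ^+ k * \prod_(r < m) \prod_(i < l) (t - r%:R - y i).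
Proof.
have hE u : (antidiff_at k y).[u] =
    meval y (antidiff ('X^k * fallpow (gpoly K l) m)).[u%:MP].
  by rewrite -horner_map /= mevalC.
have := congr1 (fun P => meval y P.[t%:MP])
  (antidiffK ('X^k * fallpow (gpoly K l) m)).
rewrite /= hornerD hornerN mevalB /shiftp horner_comp.
rewrite [('X + _).[_]]hornerD hornerX hornerC -mpolyC1 -mpolyCD -!hE => ->.
rewrite hornerM hornerXn mevalM rmorphXn /= mevalC /fallpow; congr (_ * _).
rewrite horner_prod rmorph_prod /=; apply: eq_bigr => r _.
rewrite /gpoly /shiftp horner_comp horner_prod rmorph_prod /=.
apply: eq_bigr => i _.
by rewrite !hornerE mevalB mevalD mevalN mevalC mevalXU rmorph_nat.
Qed.

(** Component [c] is the sum of all [F(y_p)] minus [l F(y_c)], and the first sum does not depend on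
    [c]. *)
Lemma zeta_subE k y i j :
  (zeta K l m k 0 i).@[y] - (zeta K l m k 0 j).@[y] =
  l%:R * ((antidiff_at k y).[y j] - (antidiff_at k y).[y i]).
Proof.
have E c : (zeta K l m k 0 c).@[y] =
    \sum_(p < l) ((antidiff_at k y).[y p] - (antidiff_at k y).[y c]).
  rewrite mxE rmorph_sum /=; apply: eq_bigr => p _.
  by rewrite /defsum mevalB -!horner_map /= !mevalXU.
rewrite !E -sumrB (eq_bigr (fun=> (antidiff_at k y).[y j] - (antidiff_at k y).[y i])).
  by rewrite sumr_const card_ord mulr_natl.
by move=> p _; ring.
Qed.

(* The factor t - r - y_i of the summand vanishes at t = y_i + r for r < m. *)
Lemma antidiff_at_shiftn k y i n : (n <= m)%N ->
  (antidiff_at k y).[y i + n%:R] = (antidiff_at k y).[y i].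
Proof.
elim: n => [|n IH] nm; first by rewrite addr0.
rewrite -natr1 addrA -[RHS](IH (ltnW nm)); apply/eqP.
rewrite -subr_eq0 antidiff_at_shift (bigD1 (Ordinal nm)) //= (bigD1 i) //=.
by rewrite addrK subrr !mul0r mulr0.
Qed.

Lemma zeta_eq_on k y i j (d : int) : - m%:Z <= d <= m%:Z ->
  y i = y j + d%:~R -> (zeta K l m k 0 i).@[y] = (zeta K l m k 0 j).@[y].
Proof.
move=> dm yij; apply/eqP; rewrite -subr_eq0 zeta_subE mulf_eq0; apply/orP; right.
(* For negative [d] the roles of [i] and [j] are exchanged. *)
case: d dm yij => n dm yij.
  by rewrite yij antidiff_at_shiftn ?subrr //; lia.
have -> : y j = y i + n.+1%:R by rewrite yij NegzE mulrNz subrK.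
by rewrite antidiff_at_shiftn ?subrr //; lia.
Qed.

Lemma vfhomogenize_xidx (e : 'rV[B]_l) i :
  vfhomogenize e 0 (xidx i) = homogenize (vfdeg e) (e 0 i).
Proof. by rewrite mxE /xidx liftK. Qed.

Lemma vfhomogenize_zidx (e : 'rV[B]_l) : vfhomogenize e 0 (zidx l) = 0.
Proof. by rewrite mxE unlift_none. Qed.

Lemma zeta_logarithmic k :
  logarithmic (@cone_indices l m) (@cone_form K l m) (vfhomogenize (zeta K l m k)).
Proof.
move=> H Hs; rewrite deriv_app_form; case: H Hs => [[[i j] c]|] Hs; last first.
  by exists 0; rewrite vfhomogenize_zidx mul0r.
rewrite vfhomogenize_zidx mulr0 subr0 !vfhomogenize_xidx.
(* Multiplying by [z] leaves only points with [z != 0] to check, where [meval_homogenize]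
   applies. *)
set e := zeta K l m k; apply/subst_var_eq0_dvd/(@mulfI _ 'X_(zidx l)).
  by rewrite -msize_poly_eq0 msizeX.
rewrite mulr0; apply: meval_eq0 => v; rewrite mevalM mevalXU.
have [->|vz] := eqVneq (v (zidx l)) 0; first by rewrite mul0r.
apply/eqP; rewrite mulf_eq0 (negPf vz) /=.
set p := _ - _; have [w w0 [wz ->]] := form_meval_restrict p v Hs.
(* The pivot is [xidx i], so the projection keeps the coordinate [z]. *)
have {}vz : w (zidx l) != 0 by rewrite wz //= eq_sym xidx_neq_zidx.
rewrite /p mevalB !meval_homogenize ?msize_leq_vfdeg // subr_eq0; apply/eqP.
congr (_ * _); apply: (@zeta_eq_on _ _ _ _ (offset c)).
  by rewrite /offset; have := ltn_ord c; lia.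
move: w0; rewrite meval_form => /eqP; rewrite subr_eq0 subr_eq => /eqP ->.
by rewrite mulrDl mulfK // addrC.
Qed.

Lemma theta0_logarithmic :
  logarithmic (@cone_indices l m) (@cone_form K l m) (theta0 K l).
Proof.
move=> H Hs; exists 0; rewrite deriv_app_form mul0r.
case: H {Hs} => [[[i j] c]|]; rewrite !mxE ?eqxx //.
by rewrite !xidx_neq_zidx subrr mulr0 subr0.
Qed.

Lemma thetaE_logarithmic :
  logarithmic (@cone_indices l m) (@cone_form K l m) (thetaE K l).
Proof.
move=> H Hs; exists 1; rewrite deriv_app_form mul1r /cone_form /cone_value.
by case: H {Hs} => [[[i j] c]|] /=; rewrite !mxE ?subr0 // opprD addrA.
Qed.

End Zeta.

Lemma nth_map_iota_cat2 (T : Type) (x0 a b : T) (f : nat -> T) n r :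
  (r < n.+2)%N -> nth x0 ([seq f k | k <- iota 0 n] ++ [:: a; b]) r =
  if (r < n)%N then f r else if r == n then a else b.
Proof.
move=> rn2; rewrite nth_cat size_map size_iota; case: ltnP => rn.
  by rewrite (nth_map 0%N) ?size_iota // nth_iota.
have [->|rn'] := eqVneq r n; first by rewrite subnn.
by have -> : (r - n = 1)%N by lia.
Qed.

(** * The candidate basis and its degrees, with [l = n.+1] *)

Section Basis.
Variables (K : numFieldType) (n m : nat).
Local Notation l := n.+1.
Local Notation A := {mpoly K[l.+1]}.

Definition catalan_basis : seq 'rV[A]_l.+1 :=
  [seq vfhomogenize (zeta K l m k) | k <- iota 0 l.-1]
    ++ [:: theta0 K l; thetaE K l].

Lemma size_catalan_basis : size catalan_basis = l.+1.
Proof. by rewrite size_cat size_map size_iota addn2. Qed.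

Lemma nth_catalan_basis r : (r < l.+1)%N -> catalan_basis`_r =
  if (r < n)%N then vfhomogenize (zeta K l m r)
  else if r == n then theta0 K l else thetaE K l.
Proof. exact: nth_map_iota_cat2. Qed.

Definition catalan_deg (r : nat) : nat :=
  if (r < n)%N then (r + m * l).+1 else if r == n then 0 else 1.

Lemma msize_catalan_basis (r c : 'I_l.+1) :
  (msize (catalan_basis`_r 0%R c) <= (catalan_deg r).+1)%N.
Proof.
rewrite nth_catalan_basis // /catalan_deg; case: ifP => _.
  apply: leq_trans (msize_vfhomogenize_leq _ _) _.
  by rewrite ltnS; apply: vfdeg_zeta_leq.
case: ifP => _; rewrite mxE; last by rewrite msizeX mdeg1.
by rewrite -mpolyC_nat msizeC; case: (_ != 0).
Qed.

(** Both sides equal [(2m+1) l (l-1) / 2 + 1]. *)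
Lemma sum_catalan_deg :
  (\sum_(r < l.+1) catalan_deg r = size (cone_indices l m))%N.
Proof.
rewrite size_cone_indices !big_ord_recr /= /catalan_deg ltnn eqxx.
rewrite ltnNge leqnSn /= gtn_eqF // addn0 addn1; congr _.+1.
under eq_bigr do rewrite ltn_ord -addnS.
rewrite big_split /= sum_nat_const card_ord.
have : ((\sum_(j < n) j) * 2 = n * n.-1)%N.
  elim: (n) => [|k IH]; first by rewrite big_ord0.
  by rewrite big_ord_recr mulnDl IH /=; case: (k) => // k'; rewrite /=; nia.
by case: (n) => [|k] /=; rewrite -?muln2; nia.
Qed.

Lemma catalan_basis_logarithmic (r : 'I_l.+1) :
  logarithmic (cone_indices l m) (@cone_form K l m) catalan_basis`_r.
Proof.
rewrite nth_catalan_basis //; case: ifP => _; first exact: zeta_logarithmic.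
by case: ifP => _; [exact: theta0_logarithmic|exact: thetaE_logarithmic].
Qed.

End Basis.

(** * Nonvanishing of the determinant *)

Section Determinant.
Variables (K : numFieldType) (n m : nat).
Local Notation l := n.+1.
Local Notation A := {mpoly K[l.+1]}.

Definition sample (i : 'I_l) : K := (m.+1 * i)%:R.

(** At [z = 1] a homogenized field takes the values of the original one. *)
Definition sample_ext (c : 'I_l.+1) : K :=
  if unlift (zidx l) c is Some i then sample i else 1.

Lemma sample_ext_xidx i : sample_ext (xidx i) = sample i.
Proof. by rewrite /sample_ext liftK. Qed.

Lemma sample_ext_zidx : sample_ext (zidx l) = 1.
Proof. by rewrite /sample_ext unlift_none. Qed.

(** The falling power of [g] at [t], for the sample point. *)
Definition sample_weight (t : K) : K :=
  \prod_(r < m) \prod_(j < l) (t - r%:R - sample j).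

(** The roots [sample j + r] have residue [r < m] modulo [m+1], whereas [sample i + m] has residue
    [m]. *)
Lemma sample_weight_neq0 (i : 'I_l) : sample_weight (sample i + m%:R) != 0.
Proof.
apply/prodf_neq0 => r _; apply/prodf_neq0 => j _.
rewrite subr_eq0 subr_eq /sample -!natrD eqr_nat; apply/negP => /eqP E.
have := congr1 (fun x => x %% m.+1)%N E.
rewrite /= ![(m.+1 * _)%N]mulnC modnMDl modnMDl.
rewrite !modn_small //; last by rewrite ltnS ltnW.
by have := ltn_ord r; lia.
Qed.

(** Of the [m+1] unit steps from [sample i] to [sample j], the first [m] contribute nothing. *)
Lemma antidiff_at_sample k (i j : 'I_l) : j = i.+1 :> nat ->
  (antidiff_at m k sample).[sample j] - (antidiff_at m k sample).[sample i] =
  (sample i + m%:R) ^+ k * sample_weight (sample i + m%:R).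
Proof.
move=> ji; have -> : sample j = sample i + m%:R + 1.
  by rewrite /sample ji mulnS -addrA natr1 -natrD addnC.
rewrite -(antidiff_at_shiftn k sample i (leqnn m)).
exact: antidiff_at_shift.
Qed.

Lemma meval_catalan_basis_zidx r : (r < l)%N ->
  ((catalan_basis K n m)`_r 0 (zidx l)).@[sample_ext] = 0.
Proof.
move=> rl; rewrite nth_catalan_basis; last exact: leqW.
case: ltnP => nr; first by rewrite vfhomogenize_zidx meval0.
have -> : r = n by lia.
by rewrite eqxx mxE eqxx meval0.
Qed.

Lemma meval_catalan_basis_zeta r (i : 'I_l) : (r < n)%N ->
  ((catalan_basis K n m)`_r 0 (xidx i)).@[sample_ext] =
  (zeta K l m r 0 i).@[sample].
Proof.
move=> rn; have rl : (r < l.+1)%N by lia.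
rewrite nth_catalan_basis // rn.
rewrite vfhomogenize_xidx meval_homogenize ?msize_leq_vfdeg //.
  rewrite sample_ext_zidx expr1n mul1r; apply: meval_eq => j.
  by rewrite sample_ext_xidx divr1.
by rewrite sample_ext_zidx oner_neq0.
Qed.

Lemma det_catalan_basis_neq0 :
  \det (\matrix_(r < l.+1, c < l.+1) (catalan_basis K n m)`_r 0 c) != 0.
Proof.
set M := \matrix_(_, _) _; apply/negP => /eqP detM.
have : \det (map_mx (meval sample_ext) M) == 0 by rewrite det_map_mx detM rmorph0.
case/det0P => u u0 uM; case/negP: u0; apply/eqP.
have hu c : \sum_(r < l.+1)
    u 0 r * ((catalan_basis K n m)`_r 0 c).@[sample_ext] = 0.
  move/rowP/(_ c): uM; rewrite !mxE => E; apply: etrans E.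
  by apply: eq_bigr => r _; rewrite !mxE.
(* In the [z] column only the row of [thetaE] is nonzero. *)
have umax : u 0 ord_max = 0.
  have := hu (zidx l); rewrite big_ord_recr /= big1 ?add0r; last first.
    by move=> r _; rewrite meval_catalan_basis_zidx ?mulr0.
  rewrite nth_catalan_basis // ltnNge leqnSn /= gtn_eqF // mxE mevalXU.
  by rewrite sample_ext_zidx mulr1.
pose a r := u 0 (inord r).
have aE (r : 'I_l.+1) : u 0 r = a r by rewrite /a inord_val.
have hx (i : 'I_l) :
    \sum_(r < n) a r * (zeta K l m r 0 i).@[sample] + a n = 0.
  have := hu (xidx i); rewrite big_ord_recr /= umax mul0r addr0 big_ord_recr /=.
  rewrite aE /= nth_catalan_basis // ltnn eqxx mxE xidx_neq_zidx meval1 mulr1.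
  move=> E; apply: etrans E; congr (_ + _).
  by apply: eq_bigr => r _; rewrite aE /= meval_catalan_basis_zeta.
pose p := \poly_(r < n) a r.
(* The size of [p] is at most [n], yet it has the [n] distinct roots [sample i + m] for [i < n]. *)
have p0 : p = 0.
  apply/eqP/contraT => /max_poly_roots.
  move=> /(_ [seq sample i + m%:R | i <- [seq inord k | k <- iota 0 n]]).
  rewrite !size_map size_iota ltnNge size_poly; apply.
    apply/allP => _ /mapP[_ /mapP[k + ->] ->]; rewrite mem_iota add0n => /= kn.
    apply/eqP/(mulIf (sample_weight_neq0 (inord k))); rewrite mul0r.
    have kE : (inord k : 'I_l) = k :> nat by rewrite inordK // ltnS ltnW.
    have kE' : (inord k.+1 : 'I_l) = (inord k : 'I_l).+1 :> nat.
      by rewrite kE inordK.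
    apply: (@mulfI _ l%:R); first by rewrite pnatr_eq0.
    rewrite mulr0 horner_poly mulr_suml mulr_sumr.
    (* Comparing consecutive columns eliminates [a n] and leaves [l] times the value of [p] times a
       nonzero weight. *)
    have /addIr/eqP := etrans (hx (inord k)) (esym (hx (inord k.+1))).
    rewrite -subr_eq0 -sumrB => /eqP E; apply: etrans E.
    apply: eq_bigr => r _; rewrite -mulrBr zeta_subE (antidiff_at_sample _ kE').
    by ring.
  rewrite map_inj_in_uniq.
    rewrite map_inj_in_uniq ?iota_uniq // => x y; rewrite !mem_iota => xn yn.
    by move/(congr1 val); rewrite /= !inordK //; lia.
  move=> x y _ _ /addIr /eqP; rewrite /sample eqr_nat eqn_pmul2l // => /eqP.
  exact: val_inj.
have a0 r : (r < n)%N -> a r = 0.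
  move=> rn; have : p`_r = 0 by rewrite p0 coef0.
  by rewrite coef_poly rn.
apply/rowP => r; rewrite mxE aE.
case: (ltngtP r n) => rn; first exact: a0.
  rewrite -aE (_ : r = ord_max) //; apply: val_inj.
  by have := ltn_ord r; rewrite /=; lia.
(* With the other coefficients zero, any [x] column gives [a n = 0]. *)
rewrite rn; have := hx ord0; rewrite big1 ?add0r // => s _.
by rewrite a0 ?mul0r.
Qed.

End Determinant.

Unset Implicit Arguments.

Theorem theorem4p1 (R : realType) (l m : nat) (hl : (2 <= l)%N) (hm : (1 <= m)%N)
    (alpha : set 'rV[R[i]]_l.+1 -> {mpoly R[i][l.+1]})
    (halpha : defining_forms (@cCat R[i] l m) alpha) :
  module_basis (logder (@cCat R[i] l m) alpha)
    ([seq vfhomogenize (zeta R[i] l m k) | k <- iota 0 l.-1]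
       ++ [:: theta0 R[i] l; thetaE R[i] l]).
Proof.
case: l hl alpha halpha => [//|n] _ alpha halpha.
rewrite -/(catalan_basis R[i] n m).
have [span free] : module_basis
    (logarithmic (cone_indices n.+1 m) (@cone_form R[i] n.+1 m))
    (catalan_basis R[i] n m).
  apply: (@saito_module_basis _ _ _ _ _ (@cone_restrict R[i] n.+1 m) _ _ _ _ _ _
            _ (fun r => catalan_deg n m r)).
  - exact: uniq_cone_indices.
  - by move=> H p; apply: subst_var_eq0_dvd.
  - exact: restrict_form.
  - exact: restrict_form_neq0.
  - by move=> H Hs; exists (cone_pivot H);
    rewrite mderiv_form_pivot // rmorph1 oner_neq0.
  - exact: msize_form.
  - exact: size_catalan_basis.
  - exact: catalan_basis_logarithmic.
  - exact: msize_catalan_basis.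
  - by rewrite sum_catalan_deg.
  - exact: det_catalan_basis_neq0.
(* Independence does not mention the module, so only the spanning part is transferred to
   [logder]. *)
split=> // d; rewrite -span; exact: logder_cCatP.
Qed.
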